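(* Let $n \geq 2$, $d \geq 2$ and $m$ be integers and let $V$ be a base point free, $m$-dimensional $k$-vector subspace of $S_d$. If $P_n(d-1) + Q_{n-1}(d-1) < m \leq P_n(d)$, then $M_{d,V}$ is stable; and if $m = P_n(d-1) + Q_{n-1}(d-1)$, then $M_{d,V}$ is semistable.
   Context: Let $k$ be an algebraically closed field of arbitrary characteristic, $\mathbb{P}^n$ the projective $n$-space over $k$, and $S = k[X_0,\ldots,X_n]$ its homogeneous coordinate ring, with $S_d$ the space of forms of degree $d$. A $k$-vector subspace $V \subseteq S_d$ is called base point free if for every $x \in \mathbb{P}^n$ there exists $f \in V$ with $f(x) \neq 0$. In this case $M_{d,V}$ denotes the kernel of the evaluation epimorphism $\mathcal{O}_{\mathbb{P}^n} \otimes_k V \rightarrow \mathcal{O}_{\mathbb{P}^n}(d)$. The polynomials $P_n, Q_{n-1} \in \mathbb{Q}[T]$ are defined by $$P_n(T) = \frac{(T+1)\cdots(T+n)}{n!}, \qquad Q_{n-1}(T) = \frac{P_n(T)-1}{T},$$ so that $\dim_k S_d = P_n(d)$ for all $d \geq 0$. (Semi)stability means slope (semi)stability with respect to $\mathcal{O}_{\mathbb{P}^n}(1)$: for a torsion free coherent sheaf $\mathcal{F}\neq 0$ on $\mathbb{P}^n$, $\deg \mathcal{F}$ is the integer $a$ with $\det \mathcal{F} \simeq \mathcal{O}_{\mathbb{P}^n}(a)$ and $\mu(\mathcal{F}) = \deg \mathcal{F} / \mathrm{rk}\, \mathcal{F}$; $\mathcal{F}$ is stable (resp. semistable) if $\mu(\mathcal{F}')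 < \mu(\mathcal{F})$ (resp. $\mu(\mathcal{F}') \leq \mu(\mathcal{F})$) for every coherent subsheaf $\mathcal{F}'$ of $\mathcal{F}$ with $0 < \mathrm{rk}\, \mathcal{F}' < \mathrm{rk}\, \mathcal{F}$. *)

(* Defs.v *)
From HB Require Import structures.
From mathcomp Require Import all_boot all_order all_algebra.
From mathcomp Require Import fraction.
From mathcomp Require Import mpoly.

Set Implicit Arguments.
Unset Strict Implicit.
Unset Printing Implicit Defensive.

Import Order.TTheory GRing.Theory Num.Theory.
Local Open Scope ring_scope.

(* Coherent sheaves on P^n are taken in the sense of varieties: P^n is its set
   of closed points over the algebraically closed field k, with the Zariski
   topology.  Let K be the field of rational functions on P^n.  A torsion free
   coherent sheaf embeds in its generic stalk, that is, in a constant sheaf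
   K^N, and an O-submodule of K^N is determined by its stalks, which are
   submodules of K^N.  Sheaves are therefore families of stalks in K^N. *)

Section ProjectiveSpace.
Context (k : closedFieldType) (n : nat).

Definition coord_ring := {mpoly k[n.+1]}.

(* K is the subfield of degree 0 elements of L. *)
Definition L := {fraction {mpoly k[n.+1]}}.

Local Notation "p %:F" := (@tofrac {mpoly k[n.+1]} p).

(* A point of P^n is represented by any of its vectors of homogeneous
   coordinates. *)
Definition pt := {x : 'rV[k]_n.+1 | x != 0}.

Definition eval_at (p : coord_ring) (x : pt) : k := p.@[fun i => val x 0 i].

(* The stalk of O(a) at x, embedded in L as the fractions p / q of forms with
   deg p - deg q = a and q(x) <> 0. *)
Definition twist (a : int) (x : pt) (f : L) : Prop :=
  exists (i j : nat) (p q : coord_ring),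
    [/\ [/\ p \is i.-homog, q \is j.-homog & i%:Z = j%:Z + a],
        eval_at q x != 0 & f = p%:F / q%:F].

Definition reg : pt -> L -> Prop := twist 0.

(* f belongs to K: a rational function is regular at some point. *)
Definition ratfun (f : L) : Prop := exists x, reg x f.

Definition reg_span (W : lmodType L) (x : pt) (A : W -> Prop) (v : W) : Prop :=
  exists (q : nat) (c : 'I_q -> L) (s : 'I_q -> W),
    [/\ forall i, reg x (c i), forall i, A (s i) & v = \sum_i c i *: s i].

Definition stalks (N : nat) := pt -> 'rV[L]_N -> Prop.

(* On a principal open neighbourhood of each point, finitely many sections
   generate every stalk; the openness of the family of stalks and the
   O-module structure are consequences.  An O-submodule of finite type of the
   constant sheaf K^N is coherent because P^n is noetherian. *)
Definition coherent N (F : stalks N) : Prop :=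
  forall x : pt, exists (e : nat) (g : coord_ring) (s : seq 'rV[L]_N),
    [/\ g \is e.-homog, eval_at g x != 0,
        forall v, v \in s -> forall i, ratfun (v 0 i)
      & forall y : pt, eval_at g y != 0 ->
          forall v, F y v <-> reg_span y (fun w => w \in s) v].

Definition subsheaf N (F' F : stalks N) : Prop :=
  forall x v, F' x v -> F x v.

(* The rows of B form a K-basis of the generic stalk K . F_x of F.  Vectors
   with entries in K are linearly independent over K if and only if they are
   over L. *)
Definition generic_basis N (F : stalks N) r (B : 'M[L]_(r, N)) : Prop :=
  [/\ row_free B,
      forall i, exists x, F x (row i B)
    & forall x v, F x v -> (v <= B)%MS].

Definition has_rank N (F : stalks N) (r : nat) : Prop :=
  exists B : 'M[L]_(r, N), generic_basis F B.

(* The r-th exterior power of F modulo torsion, as a subsheaf of K: the basis B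
   identifies the exterior power of the generic stalk with K, and sends
   f_1 ^ ... ^ f_r to the determinant of the coordinates of the f_i in B. *)
Definition ext_power N (F : stalks N) r (B : 'M[L]_(r, N))
    (x : pt) : L -> Prop :=
  @reg_span L^o x (fun f => exists C : 'M[L]_r,
    (forall i, F x (row i (C *m B))) /\ f = \det C).

(* The stalk of Hom(D, O), for a nonzero coherent subsheaf D of K. *)
Definition dual (D : pt -> L -> Prop) (x : pt) (g : L) : Prop :=
  ratfun g /\ forall f, D x f -> reg x (g * f).

(* det F is the reflexive hull of the exterior power of order rk F. *)
Definition det_sheaf N (F : stalks N) r (B : 'M[L]_(r, N)) :
  pt -> L -> Prop := dual (dual (ext_power F B)).

(* det F is isomorphic to O(a): an isomorphism between nonzero rank one
   subsheaves of the constant sheaf L is the multiplication by a nonzero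
   element of L.  The choice of B does not matter, since det_sheaf F B and
   det_sheaf F B' differ by a factor in K. *)
Definition has_degree N (F : stalks N) (a : int) : Prop :=
  exists (r : nat) (B : 'M[L]_(r, N)), generic_basis F B /\
    exists2 c : L, c != 0 &
      forall x f, det_sheaf F B x f <-> twist a x (c * f).

Definition slope (r : nat) (a : int) : rat := a%:~R / r%:R.

(* Ranks and degrees of coherent sheaves exist and are unique. *)
Definition slope_stable_for (ltmu : rel rat) N (F : stalks N) : Prop :=
  coherent F /\
  exists (r : nat) (a : int),
    [/\ (0 < r)%N, has_rank F r, has_degree F a
      & forall (F' : stalks N) (r' : nat) (a' : int),
          coherent F' -> subsheaf F' F ->
          has_rank F' r' -> (0 < r' < r)%N -> has_degree F' a' ->
          ltmu (slope r' a') (slope r a)].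

Definition stable N (F : stalks N) : Prop :=
  slope_stable_for (fun u v => u < v) F.
Definition semistable N (F : stalks N) : Prop :=
  slope_stable_for (fun u v => u <= v) F.

Section SyzygySheaf.
Context (d : nat) (V : {vspace dhomog n.+1 k d}).

Definition base_point_free : Prop :=
  forall x : pt, exists2 f, f \in V & eval_at (mpoly_of_dhomog f) x != 0.

(* The evaluation map from O (x) V, identified with O^(dim V) by a basis of V,
   to O(d). *)
Definition evaluation (s : 'rV[L]_(\dim V)) : L :=
  \sum_(i < \dim V) s 0 i * (mpoly_of_dhomog (tnth (vbasis V) i))%:F.

Definition syzygy_sheaf : stalks (\dim V) :=
  fun x s => (forall i, reg x (s 0 i)) /\ evaluation s = 0.

End SyzygySheaf.
End ProjectiveSpace.

Arguments base_point_free {k n d} V.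
Arguments syzygy_sheaf {k n d} V x s.
Arguments stable {k n N} F.
Arguments semistable {k n N} F.

Definition P_poly (n : nat) : {poly rat} :=
  (n`!%:R)^-1 *: \prod_(1 <= i < n.+1) ('X + (i%:R)%:P).

(* Q_poly n.-1 is (P_poly n - 1) / 'X, for n > 0. *)
Definition Q_poly (n : nat) : {poly rat} := (P_poly n.+1 - 1) %/ 'X.

Lemma Q_polyE n : Q_poly n * 'X = P_poly n.+1 - 1.
Proof.
apply: divpK; rewrite -['X]subr0 -polyC0 dvdp_XsubCl /root /P_poly.
rewrite !hornerE horner_prod (eq_bigr (fun i : nat => i%:R)) => [|i _].
  by rewrite -natr_prod -fact_prod mulVf ?subrr // pnatr_eq0 -lt0n fact_gt0.
by rewrite !hornerE.
Qed.

(* Main.v *)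
Require Import Defs.
From HB Require Import structures.
From mathcomp Require Import all_boot all_order all_algebra.
From mathcomp Require Import fraction.
From mathcomp Require Import mpoly.
From mathcomp Require Import zify ring lra.

Import Order.TTheory GRing.Theory Num.Theory.
Local Open Scope ring_scope.

Set Implicit Arguments.
Unset Strict Implicit.
Unset Printing Implicit Defensive.

(** Write M for the syzygy sheaf, f_1, ..., f_m for the basis of V, S for the
    coordinate ring and S_e for its forms of degree e.  The sheaf M has rank
    m - 1 and degree -d, so stability says that -e/r < -d/(m-1) for the subsheaves
    of rank r < m - 1 and degree -e.

    The geometric input is a form of M. Green's vanishing theorem, used only
    for decomposable tensors: if F is a subsheaf of M of rank r and degree -e,
    then r < dim S_e ([rank_lt_of_degree]).  A generic basis of F is an r x m
    matrix B killed by the column of the f_j.  For constant vectors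
    w_1, ..., w_r in k^m the determinants det (w_i . B_j), divided by one
    constant c of L, are global sections of O(e), that is forms of degree e
    ([global_sections]).  They form a multilinear function of the w_i, whose
    value is a form vanishing at y as soon as some w_i is the vector
    (f_j(y))_j.  If r >= dim S_e, such a function is zero
    ([green_vanishing]): each substitution w_1 := (f_j(y))_j leaves one slot
    less and values in a hyperplane of the space of values, and the vectors
    (f_j(y))_j with y general span k^m because the f_j are linearly
    independent.  But some minor of B is nonzero, a contradiction.

    The identification of the global sections of O(e) avoids unique
    factorization in S: a rational function p/q which is regular everywhere is
    restricted to all the lines of P^n through a point b with q(b) <> 0, where
    q divides p by the theory of polynomials in one variable, and q is, up to
    a unit, monic in the direction b, so that q divides p globally
    ([global_quotient]).

    The degree of M is computed from explicit bases: where f_i does not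
    vanish, M is free on the relations e_j - (f_j / f_i) e_i with j <> i, and
    the change from the basis of index i to that of index 1 has determinant
    +- f_1 / f_i, as for the transition functions of O(-d) ([relations_ext_power]).

    The rest is arithmetic.  Put q = (P_n(d-1) - 1)/(d-1) = Q_{n-1}(d-1).  If
    e >= d then -e/r < -d/(m-1) since r < m - 1.  If e <= d - 1 then
    r <= P_n(e) - 1 <= e q because (P_n(e) - 1)/e increases with e
    ([binomial_quotient_mono]), while the hypothesis on m says that m - 1 is
    larger than d q, or equal to it ([slope_bound]). *)

(** * Polynomials in several variables over an infinite field *)

Lemma meval_muni (R : comNzRingType) n (p : {mpoly R[n.+1]}) (x : 'I_n.+1 -> R) :
  p.@[x] = (map_poly (meval (fun i : 'I_n => x (widen_ord (leqnSn n) i)))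
             (muni p)).[x ord_max].
Proof.
rewrite mevalE muniE rmorph_sum horner_sum /=; apply: eq_bigr => m _.
rewrite map_polyZ map_polyXn /= hornerZ hornerXn mevalZ mevalX -mulrA.
by rewrite big_ord_recr /=; congr (_ * (_ * _)); apply: eq_bigr => i _; rewrite mnmE.
Qed.

Lemma muni_eq0 (R : nzRingType) n (p : {mpoly R[n.+1]}) :
  muni p = 0 -> p = 0.
Proof.
move=> p0; apply/mpolyP => m; rewrite mcoeff0.
have := congr1 (fun q : {poly {mpoly R[n]}} =>
  (q`_(m ord_max))@_[multinom (m (widen_ord (leqnSn n) i)) | i < n]) p0.
rewrite coef0 mcoeff0 => <-; rewrite muniE coef_sum raddf_sum /=.
rewrite (eq_bigr (fun m' : 'X_{1..n.+1} => if m' == m then p@_m else 0)); last first.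
  move=> m' _; rewrite coefZ coefXn; have [->|ne] := eqVneq m' m.
    by rewrite eqxx mulr1 mcoeffZ mcoeffX eqxx mulr1.
  case: eqVneq => [e1|_]; last by rewrite mulr0 mcoeff0.
  rewrite mulr1 mcoeffZ mcoeffX; case: eqVneq => [e2|_]; last by rewrite mulr0.
  case/eqP: ne; apply/mnmP => i; have [j ->|->] := unliftP ord_max i; last by [].
  move/mnmP: e2 => /(_ j); rewrite !mnmE.
  suff -> : lift ord_max j = widen_ord (leqnSn n) j by [].
  by apply/val_inj; rewrite /= /bump leqNgt ltn_ord.
case: (boolP (m \in msupp p)) => [mp|/memN_msupp_eq0 ->].
  by rewrite (bigD1_seq m) ?msupp_uniq //= eqxx big1 ?addr0 // => i /negPf ->.
by rewrite big1 // => i _; case: ifP.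
Qed.

(** The leading coefficient in the last variable is a polynomial in fewer
    variables: at a point where it is nonzero, a polynomial in one variable is
    left, which has a nonroot since k is infinite. *)
Lemma mpoly_exists_nonroot (k : closedFieldType) n (p : {mpoly k[n]}) :
  p != 0 -> exists x, p.@[x] != 0.
Proof.
elim: n p => [|n IH] p p0.
  exists (fun=> 0); apply: contra_neq p0 => p0; apply/mpolyP => m.
  rewrite mcoeff0 -p0 mevalE.
  have all0 : forall m' : 'X_{1..0}, m' = m by move=> m'; apply/mnmP; case.
  case: (boolP (m \in msupp p)) => [mp|/[dup] mp /memN_msupp_eq0 ->].
    rewrite (bigD1_seq m) ?msupp_uniq //= big_ord0 mulr1 big1 ?addr0 // => i.
    by rewrite (all0 i) eqxx.
  by rewrite big_seq big1 // => i; rewrite (all0 i) (negPf mp).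
have q0 : muni p != 0 by apply: contra_neq p0; apply: muni_eq0.
have [y yq] := IH (lead_coef (muni p)) ltac:(by rewrite lead_coef_eq0).
have /closed_nonrootP[t /negP rt] : map_poly (meval y) (muni p) != 0.
  by rewrite -lead_coef_eq0 lead_coef_map_eq.
exists (fun i => if unlift ord_max i is Some j then y j else t).
rewrite meval_muni unlift_none; apply/negP => z; apply: rt; apply/rootP.
move/eqP: z => z; rewrite -[RHS]z; congr (_.[_]); apply: eq_map_poly => c.
apply: meval_eq => i.
have -> : widen_ord (leqnSn n) i = lift ord_max i.
  by apply/val_inj; rewrite /= /bump leqNgt ltn_ord.
by rewrite liftK.
Qed.

(** * Restriction to the lines of a given direction *)

(** Divisibility in k[T] can be tested at each point t, because a reduced
    denominator which is not constant has a root. *)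
Lemma dvdp_local (k : closedFieldType) (p q : {poly k}) : q != 0 ->
  (forall t, exists u v, v.[t] != 0 /\ p * v = u * q) -> q %| p.
Proof.
move=> q0 loc; set g := gcdp p q.
have g0 : g != 0 by rewrite gcdp_eq0 negb_and q0 orbT.
have defp : p = (p %/ g) * g by rewrite divpK // dvdp_gcdl.
have defq : q = (q %/ g) * g by rewrite divpK // dvdp_gcdr.
have cop : coprimep (q %/ g) (p %/ g).
  by rewrite coprimep_sym coprimep_div_gcd // q0 orbT.
suff : size (q %/ g) == 1.
  case/size_poly1P => c c0 qg; rewrite defq qg mul_polyC dvdpZl //.
  exact: dvdp_gcdl.
apply/negPn/negP => /closed_rootP[t rt].
have [u [v [vt /eqP]]] := loc t.
rewrite {1}defp {1}defq mulrAC mulrA (inj_eq (mulIf g0)) => /eqP E.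
have /eqP := congr1 (fun r : {poly k} => r.[t]) E.
rewrite !hornerM (rootP rt) mulr0 mulf_eq0 (negPf vt) orbF.
by apply/negP; apply: coprimep_root cop rt.
Qed.

Section Shift.
Context (R : comNzRingType) (n : nat).
Implicit Types (p q : {mpoly R[n]}) (a b : 'I_n -> R).

(** The restriction p(a + T b) of p to a line. *)
Definition line a b p : {poly R} :=
  mmap polyC (fun i => (a i)%:P + b i *: 'X) p.

(** The generic line p(X + T b) of direction b. *)
Definition shift b p : {poly {mpoly R[n]}} :=
  mmap (polyC \o @mpolyC n R) (fun i => ('X_i)%:P + (b i)%:MP *: 'X) p.

HB.instance Definition _ a b := GRing.RMorphism.copy (line a b)
  (mmap polyC (fun i => (a i)%:P + b i *: 'X)).
HB.instance Definition _ b := GRing.RMorphism.copy (shift b)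
  (mmap (polyC \o @mpolyC n R) (fun i => ('X_i)%:P + (b i)%:MP *: 'X)).

Lemma line_shift a b p : map_poly (meval a) (shift b p) = line a b p.
Proof.
rewrite /line /shift /mmap rmorph_sum; apply: eq_bigr => m _ /=.
rewrite rmorphM /= map_polyC /= mevalC rmorph_prod; congr (_ * _).
apply: eq_bigr => i _; rewrite rmorphXn; congr (_ ^+ _).
by rewrite rmorphD /= map_polyC /= mevalXU map_polyZ map_polyX /= mevalC.
Qed.

Lemma horner_line a b p t : (line a b p).[t] = p.@[fun i => a i + t * b i].
Proof.
rewrite /line /mmap horner_sum mevalE; apply: eq_bigr => m _ /=.
rewrite hornerM hornerC; congr (_ * _); rewrite horner_prod.
by apply: eq_bigr => i _; rewrite !hornerE mulrC.
Qed.

Lemma shift0 b p : (shift b p).[0] = p.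
Proof.
rewrite /shift /mmap horner_sum [RHS]mpolyE; apply: eq_bigr => m _ /=.
rewrite hornerM hornerC mul_mpolyC [in RHS]mpolyXE_id; congr (_ *: _).
by rewrite horner_prod; apply: eq_bigr => i _; rewrite !hornerE.
Qed.

(** P has T-degree at most d and c as the coefficient of degree d; unlike a
    condition on lead_coef, it is multiplicative even when c is zero. *)
Definition top_coef d (c : {mpoly R[n]}) (P : {poly {mpoly R[n]}}) :=
  (size P <= d.+1)%N /\ P`_d = c.

Lemma top_coefM d1 c1 P1 d2 c2 P2 : top_coef d1 c1 P1 -> top_coef d2 c2 P2 ->
  top_coef (d1 + d2) (c1 * c2) (P1 * P2).
Proof.
move=> [s1 e1] [s2 e2]; split.
  apply: leq_trans (size_polyMleq _ _) _.
  by move: s1 s2; case: (size P1) => [|s]; case: (size P2) => [|s'] //=;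
     rewrite ?addn0 ?addnS => *; rewrite ?ltnS; [lia|lia|lia..].
have lt1 : (d1 < (d1 + d2).+1)%N by rewrite ltnS leq_addr.
rewrite coefM (bigD1 (Ordinal lt1)) //= addKn e1 e2 big1 ?addr0 // => i ne.
have [lt|ge] := ltnP i d1.
  rewrite [X in _ * X]nth_default ?mulr0 //; apply: leq_trans s2 _; lia.
rewrite [X in X * _]nth_default ?mul0r //; apply: leq_trans s1 _.
by rewrite ltn_neqAle ge andbT eq_sym -val_eqE in ne *.
Qed.

Lemma top_coefX d c P m : top_coef d c P -> top_coef (d * m) (c ^+ m) (P ^+ m).
Proof.
move=> h; elim: m => [|m IH].
  by rewrite muln0 !expr0; split; rewrite ?size_poly1 ?coefC.
by rewrite mulnS !exprS; apply: top_coefM.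
Qed.

(** For a form p of degree d, the coefficient of T ^ d in p(X + T b) is the
    constant p(b): hence p is monic in the direction b as soon as p(b) = 1. *)
Lemma shift_top_coef b d p : p \is d.-homog -> top_coef d (p.@[b])%:MP (shift b p).
Proof.
move=> /dhomogP hp; rewrite /shift /mmap mevalE.
suff step (m : 'X_{1..n}) : top_coef (mdeg m) (\prod_(i < n) b i ^+ m i)%:MP
    (mmap1 (fun i => ('X_i)%:P + (b i)%:MP *: 'X) m : {poly {mpoly R[n]}}).
  split.
    apply: (leq_trans (size_sum _ _ _)); apply/bigmax_leqP_seq => m mp _.
    have [s _] := step m; rewrite -(hp _ mp) (leq_trans _ s) //=.
    by rewrite mul_polyC size_scale_leq.
  rewrite coef_sum raddf_sum /= big_seq [RHS]big_seq; apply: eq_bigr => m mp.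
  have [_ e] := step m; move: e; rewrite coefCM (hp _ mp) => ->.
  by rewrite mpolyCM.
rewrite /mmap1 mdegE; elim/big_rec3: _ => [|i P c e _ IH].
  by split; rewrite ?size_poly1 ?coefC.
rewrite mpolyCM; apply: top_coefM IH; rewrite -[m i]mul1n rmorphXn mul1n.
rewrite -[X in top_coef X]mul1n; apply: top_coefX; split.
  apply: leq_trans (size_polyD _ _) _; rewrite geq_max.
  rewrite (leq_trans (size_polyC_leq1 _)) //=.
  by rewrite (leq_trans (size_scale_leq _ _)) // size_polyX.
by rewrite coefD coefC coefZ coefX add0r mulr1.
Qed.
End Shift.

(** * Global sections of the twisting sheaves *)

Lemma homog_quotient (k : idomainType) n i j (h p q : {mpoly k[n]}) :
  p \is i.-homog -> q \is j.-homog -> q != 0 -> p != 0 -> h * q = p ->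
  (j <= i)%N /\ h \is (i - j).-homog.
Proof.
move=> hp hq q0 p0 hqp.
have defh : h = \sum_(d < msize h | (d + j == i)%N) pihomog mdeg d h.
  apply: (mulIf q0); rewrite hqp mulr_suml -(pihomog_dE hp) -hqp.
  rewrite [X in X * q](@pihomog_partitionE _ _ mdeg (msize h)) //.
  rewrite mulr_suml linear_sum /= [RHS]big_mkcond; apply: eq_bigr => d _.
  have hd := dhomogM (pihomogP mdeg d h) hq.
  by case: eqP => [<-|/eqP ne]; [rewrite pihomog_dE | rewrite (pihomog_ne0 ne)].
have le_ji : (j <= i)%N.
  rewrite leqNgt; apply: contra p0 => lt_ij; rewrite -hqp defh big1 ?mul0r //.
  by move=> d /eqP e; move: lt_ij; rewrite -e ltnNge leq_addl.
split=> //; rewrite defh rpred_sum // => d /eqP <-.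
by rewrite addnK; exact: pihomogP.
Qed.

Lemma mpolyX_neq0 (R : nzRingType) n (m : 'X_{1..n}) : 'X_[m] != 0 :> {mpoly R[n]}.
Proof.
apply/negP => /eqP/(congr1 (mcoeff m)) /eqP.
by rewrite mcoeffX eqxx mcoeff0 oner_eq0.
Qed.

Section ProjectiveSpace.
Context (k : closedFieldType) (n : nat).
Local Notation S := {mpoly k[n.+1]}.
Local Notation L := (L k n).
Local Notation pt := (pt k n).
Local Notation "p %:F" := (@tofrac {mpoly k[n.+1]} p).

Definition point_of (a : 'I_n.+1 -> k) (i : 'I_n.+1) (ai : a i != 0) : pt.
Proof.
exists (\row_j a j); apply: contraNneq ai => /rowP/(_ i).
by rewrite !mxE => ->.
Defined.

Lemma eval_point_of a i (ai : a i != 0) p : eval_at p (point_of ai) = p.@[a].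
Proof. by apply: meval_eq => j; rewrite mxE. Qed.

Lemma pt_coord (x : pt) : exists i, val x 0 i != 0.
Proof.
case: x => x /= x0; apply/existsP; apply: contraNT x0 => /existsPn nz.
by apply/eqP/rowP => j; rewrite mxE; apply/eqP/negPn/nz.
Qed.

Definition pt0 : pt := @point_of (fun=> 1) ord0 (oner_neq0 k).

Lemma exists_point (p : S) : p != 0 -> exists x : pt, eval_at p x != 0.
Proof.
move=> p0; have /mpoly_exists_nonroot[a] : p * 'X_ord0 != 0.
  by rewrite mulf_neq0 // mpolyX_neq0.
rewrite mevalM mevalXU mulf_eq0 => /norP[pa a0].
by exists (point_of a0); rewrite eval_point_of.
Qed.

Lemma vanish_at_points (p : S) : (forall x : pt, eval_at p x = 0) -> p = 0.
Proof.
move=> p0; apply/eqP; apply: contraT => /exists_point[x].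
by rewrite p0 eqxx.
Qed.

Lemma eval_neq0 (q : S) x : eval_at q x != 0 -> q != 0.
Proof. by apply: contraNneq => ->; rewrite /eval_at meval0. Qed.

(** After rescaling, q is monic in the direction b of x0, and p can be divided
    by q along the generic line of direction b.  On each line that avoids the
    origin the local hypothesis makes q divide p, so that the remainder
    vanishes there; such lines are dense since the cone has dimension n + 1 > 1.
    For n = 0 there are none, and indeed O(-1) has sections on a point. *)
Lemma global_quotient (p q : S) j (x0 : pt) : (0 < n)%N ->
  q \is j.-homog -> eval_at q x0 != 0 ->
  (forall x : pt, exists u v, eval_at v x != 0 /\ p * v = u * q) ->
  exists h, h * q = p.
Proof.
move=> n_gt0 hq qx0 loc; set b := fun i => val x0 0 i.
wlog qb1 : p q hq qx0 loc / q.@[b] = 1.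
  move=> wl; set c := (eval_at q x0)^-1; have c0 : c != 0 by rewrite invr_eq0.
  have [h hqp] : exists h, h * (c *: q) = c *: p.
    apply: wl; rewrite ?dhomogZ //.
    - by rewrite /eval_at mevalZ mulf_neq0.
    - move=> x; have [u [v [vx E]]] := loc x; exists u, v; split=> //.
      by rewrite -scalerAl E scalerAr.
    - by rewrite mevalZ mulVf.
  by exists h; apply: (scalerI c0); rewrite -hqp scalerAr.
pose P := shift b p; pose Q := shift b q.
have [sQ eQ] := shift_top_coef b hq; rewrite qb1 mpolyC1 -/Q in sQ eQ.
have szQ : size Q = j.+1.
  by apply/eqP; rewrite eqn_leq sQ ltnNge; apply/negP => /leq_sizeP/(_ _ (leqnn _))/eqP;
     rewrite eQ oner_eq0.
have mQ : Q \is monic by apply/monicP; rewrite lead_coefE szQ.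
have [i0 bi0] := pt_coord x0.
have [j0 ji0] : exists j0 : 'I_n.+1, j0 != i0.
  case: (eqVneq i0 ord0) => [->|]; last by exists ord0; rewrite eq_sym.
  by exists ord_max; rewrite -val_eqE /= -lt0n.
(* A linear form that is constant along b, so that the line a + T b avoids the
   origin when l(a) <> 0. *)
pose l : S := b i0 *: 'X_j0 - b j0 *: 'X_i0.
have l0 : l != 0.
  suff : l@_U_(j0) != 0 by apply: contraNneq => ->; rewrite mcoeff0.
  rewrite mcoeffB !mcoeffZ !mcoeffXU eqxx [i0 == _]eq_sym (negPf ji0).
  by rewrite mulr0 subr0 mulr1.
pose Rm := Pdiv.Ring.rmodp P Q.
have R0 a : l.@[a] != 0 -> map_poly (meval a) Rm = 0.
  move=> la; have mQa : line a b q \is monic.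
    by rewrite -line_shift monic_map.
  have Qa0 := monic_neq0 mQa.
  have PQ : line a b p = map_poly (meval a) (Pdiv.Ring.rdivp P Q) * line a b q +
              map_poly (meval a) Rm.
    rewrite -!line_shift -rmorphM -rmorphD /=.
    by congr map_poly; apply: Pdiv.RingMonic.rdivp_eq.
  have dvd : line a b q %| line a b p.
    apply: dvdp_local Qa0 _ => t.
    have lt : l.@[fun i => a i + t * b i] = l.@[a].
      by rewrite /l !mevalB !mevalZ !mevalXU; ring.
    have [i xi] : exists i, a i + t * b i != 0.
      apply/existsP; apply: contraNT la => /existsPn nz.
      have nz' i : a i + t * b i = 0 by apply/eqP/negPn/nz.
      by rewrite -lt /l mevalB !mevalZ !mevalXU !nz' !mulr0 subr0.
    have [u [v [vx E]]] := loc (@point_of (fun i => a i + t * b i) i xi).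
    exists (line a b u), (line a b v); rewrite horner_line -(eval_point_of xi).
    by rewrite -!rmorphM E.
  have : line a b q %| map_poly (meval a) Rm.
    move: dvd; rewrite PQ dvdp_addr //; exact: dvdp_mull.
  apply: contraTeq => Rn0; apply/negP => /(dvdp_leq Rn0).
  apply/negP; rewrite -ltnNge -line_shift (@size_map_poly_id0 _ _ (meval a) Q); last first.
    by rewrite (monicP mQ) meval1 oner_neq0.
  apply: leq_ltn_trans (size_poly _ _) _.
  by apply: Pdiv.Ring.ltn_rmodpN0; apply: monic_neq0.
have Rm0 : Rm = 0.
  apply/polyP => i; rewrite coef0; apply/eqP/negPn/negP => ri.
  have /mpoly_exists_nonroot[a] : l * Rm`_i != 0 by rewrite mulf_neq0.
  rewrite mevalM mulf_eq0 => /norP[la]; have /polyP/(_ i) := R0 a la.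
  by rewrite coef_map coef0 /= => ->; rewrite eqxx.
(* X is the point T = 0 of the generic line through X. *)
exists (Pdiv.Ring.rdivp P Q).[0].
have PQ : P = Pdiv.Ring.rdivp P Q * Q.
  by have := Pdiv.RingMonic.rdivp_eq mQ P; rewrite -/Rm Rm0 addr0.
by rewrite -(shift0 b q) -hornerM -PQ (shift0 b p).
Qed.

Lemma tofrac_neq0 (q : S) : (q%:F != 0) = (q != 0).
Proof. by rewrite tofrac_eq0. Qed.

Lemma frac_eq (p q u v : S) : q != 0 -> v != 0 ->
  p%:F / q%:F = u%:F / v%:F -> p * v = u * q.
Proof.
move=> q0 v0 /eqP; rewrite eqr_div ?tofrac_neq0 // -!tofracM tofrac_eq.
by move/eqP.
Qed.

(** H^0(P^n, O(a)) consists of the forms of degree a, hence vanishes for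
    a < 0.  The degree is an output because only nonzero sections show that
    it is nonnegative. *)
Lemma global_sections (a : int) (f : L) : (0 < n)%N ->
  (forall x, twist a x f) -> f != 0 ->
  exists (e : nat) (h : dhomog n.+1 k e), a = e /\ f = (mpoly_of_dhomog h)%:F.
Proof.
move=> n_gt0 glob f0.
have [i [j [p [q [[hp hq ija] qx0 deff]]]]] := glob pt0.
have q0 := eval_neq0 qx0.
have [h hqp] : exists h, h * q = p.
  apply: (global_quotient n_gt0 hq qx0) => x.
  have [_ [_ [u [v [_ vx deff']]]]] := glob x; exists u, v; split=> //.
  by apply: frac_eq => //; [apply: eval_neq0 vx | rewrite -deff].
have p0 : p != 0 by apply: contraNneq f0; rewrite deff => ->; rewrite tofrac0 mul0r.
have [le_ji hh] := homog_quotient hp hq q0 p0 hqp.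
exists (i - j)%N, (DHomog hh); split; first by lia.
have qF0 : q%:F != 0 by rewrite tofrac_neq0.
by rewrite deff -hqp tofracM -mulrA (divff qF0) mulr1.
Qed.
End ProjectiveSpace.

(** * A vanishing theorem in the style of Green *)

(** Multilinearity in r vectors.  The arguments are given as a list, so that
    fixing the first of them leaves a function of the same kind; the condition
    bears on lists of size r only. *)
Definition multilin (R : nzRingType) (W : lmodType R) m r
    (Phi : seq 'rV[R]_m -> W) :=
  forall s1 s2 a v w, (size s1 + size s2).+1 = r ->
  Phi (s1 ++ (a *: v + w) :: s2) = a *: Phi (s1 ++ v :: s2) + Phi (s1 ++ w :: s2).

Lemma multilin_sum (R : nzRingType) (W : lmodType R) m r
    (Phi : seq 'rV[R]_m -> W) s1 s2 (w : 'rV[R]_m) :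
  multilin r Phi -> (size s1 + size s2).+1 = r ->
  Phi (s1 ++ w :: s2) = \sum_j w 0 j *: Phi (s1 ++ delta_mx 0 j :: s2).
Proof.
move=> lin sz; have lin1 a v v' := lin s1 s2 a v v' sz.
have P0 : Phi (s1 ++ 0 :: s2) = 0.
  have := lin1 1 0 0; rewrite scaler0 addr0 scale1r => E.
  by apply: (addrI (Phi (s1 ++ 0 :: s2))); rewrite addr0 -E.
rewrite {1}[w]row_sum_delta.
elim: (index_enum _) => [|j l IH]; first by rewrite !big_nil.
by rewrite !big_cons -IH; exact: lin1.
Qed.

Section Green.
Context (k : closedFieldType) (n e m : nat) (f : 'I_m -> {mpoly k[n.+1]}).
Hypothesis f_free : forall c : 'I_m -> k, \sum_j c j *: f j = 0 -> forall j, c j = 0.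

Local Notation form := (dhomog n.+1 k e).
Local Notation pt := (pt k n).
Implicit Types (Phi : seq 'rV[k]_m -> form) (U : {vspace form}) (s : seq 'rV[k]_m).

Definition values_at (y : pt) : 'rV[k]_m := \row_j eval_at (f j) y.

(** Pointwise form of the Koszul relation: contracting a section of an exterior
    power of the syzygy sheaf with the evaluation at y gives zero at y. *)
Definition vanishing r Phi := forall s1 s2 y, (size s1 + size s2).+1 = r ->
  eval_at (Phi (s1 ++ values_at y :: s2)) y = 0.

Definition form_eval (y : pt) (h : form) : k^o := eval_at h y.

Lemma form_eval_is_linear y : linear (form_eval y).
Proof. 
move=> a h h'.
by rewrite /form_eval /eval_at mpoly_of_dhomog_is_linear mevalD mevalZ.
Qed.
HB.instance Definition _ y := GRing.isLinear.Build k form k^o _ (form_eval y)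
  (form_eval_is_linear y).

(** Induction on r.  Let u be a nonzero form in U.  When u(y) <> 0,
    substituting the vector of values at y for the first argument gives values
    in the forms of U that vanish at y, a proper subspace of U, and one
    argument less: the result is zero.  Such vectors of values span k^m,
    because a linear form that vanishes on them is a linear combination of the
    f_j whose product with u is zero; so Phi vanishes on all of k^m in its
    first argument. *)
Lemma green_vanishing r Phi U : multilin r Phi -> vanishing r Phi ->
  (forall s, size s = r -> Phi s \in U) -> (\dim U <= r)%N ->
  forall s, size s = r -> Phi s = 0.
Proof.
elim: r Phi U => [|r IH] Phi U lin van inU dimU s sz.
  move: dimU (inU s sz); rewrite leqn0 dimv_eq0 => /eqP ->.
  by rewrite memv0 => /eqP.
have [U0|Un0] := eqVneq U 0%VS; first by move: (inU s sz); rewrite U0 memv0 => /eqP.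
have [u uU un0] : exists2 u, u \in U & u != 0.
  by exists (vpick U); rewrite ?memv_pick // vpick0.
case: s sz => [//|w s] [sz].
have Phi_y y : eval_at u y != 0 -> Phi (values_at y :: s) = 0.
  move=> uy; pose Uy := (U :&: lker (linfun (form_eval y)))%VS.
  apply: (IH (fun s => Phi (values_at y :: s)) Uy) => //.
  - by move=> s1 s2 a v v' E; apply: (lin (_ :: _)); rewrite /= addSn E.
  - by move=> s1 s2 z E; apply: (van (_ :: _)); rewrite /= addSn E.
  - move=> s' sz'; rewrite memv_cap inU /= ?sz' // memv_ker lfunE /=.
    by rewrite /form_eval (van [::]) // sz'.
  - rewrite -ltnS; apply: leq_trans dimU.
    have sub : (Uy <= U)%VS by exact: capvSl.
    rewrite ltn_neqAle dimvS // andbT (dimv_leqif_sup sub).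
    apply: contra uy => /subvP/(_ u uU).
    by rewrite memv_cap memv_ker lfunE /= => /andP[_].
rewrite (multilin_sum (s1 := [::]) _ lin (congr1 S sz)) big1 // => j _.
suff -> : Phi (delta_mx 0 j :: s) = 0 by rewrite scaler0.
(* For each monomial, its coefficients in the forms Phi (e_j :: s) will be
   those of a linear dependence between the f_j. *)
apply/val_inj/mpolyP => mm /=; rewrite mcoeff0.
apply: (f_free (c := fun j => (mpoly_of_dhomog (Phi (delta_mx 0 j :: s)))@_mm)).
have u0 : mpoly_of_dhomog u != 0 by apply: contra_neq un0 => u0; apply: val_inj.
apply: (mulfI u0); rewrite mulr0; apply: vanish_at_points => y.
rewrite /eval_at mevalM; have [uy|uy] := eqVneq (eval_at u y) 0.
  by move: uy; rewrite /eval_at => ->; rewrite mul0r.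
rewrite raddf_sum /=.
have := Phi_y y uy; rewrite (multilin_sum (s1 := [::]) _ lin (congr1 S sz)).
move/(congr1 (fun h => (mpoly_of_dhomog h)@_mm)).
rewrite mcoeff0 linear_sum /= raddf_sum /= => E.
rewrite (eq_bigr (fun j => (values_at y 0 j *: Phi (delta_mx 0 j :: s))@_mm)).
  by rewrite E mulr0.
by move=> i _; rewrite mevalZ mxE mulrC; exact/esym/mcoeffZ.
Qed.
End Green.

(** * Stalks of the twisting sheaves and duality *)

Section Twists.
Context (k : closedFieldType) (n : nat).
Local Notation S := {mpoly k[n.+1]}.
Local Notation L := (L k n).
Local Notation pt := (pt k n).
Local Notation "p %:F" := (@tofrac {mpoly k[n.+1]} p).
Implicit Types (x : pt) (f g : L) (a b : int).

Lemma twistM a b x f g : twist a x f -> twist b x g -> twist (a + b) x (f * g).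
Proof.
case=> i [j [p [q [[hp hq ija] qx ->]]]] [i' [j' [p' [q' [[hp' hq' ija'] qx' ->]]]]].
exists (i + i')%N, (j + j')%N, (p * p'), (q * q'); split.
- by split; [apply: dhomogM | apply: dhomogM | lia].
- by rewrite /eval_at mevalM mulf_neq0.
- by rewrite !tofracM mulf_div.
Qed.

Lemma twistD a x f g : twist a x f -> twist a x g -> twist a x (f + g).
Proof.
case=> i [j [p [q [[hp hq ija] qx ->]]]] [i' [j' [p' [q' [[hp' hq' ija'] qx' ->]]]]].
exists (i + j')%N, (j + j')%N, (p * q' + p' * q), (q * q'); split.
- split; [|by apply: dhomogM | by lia].
  apply: dhomogD; first exact: dhomogM.
  have -> : (i + j' = i' + j)%N by lia.
  exact: dhomogM.
- by rewrite /eval_at mevalM mulf_neq0.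
- by rewrite tofracD !tofracM addf_div // tofrac_neq0 (eval_neq0 qx, eval_neq0 qx').
Qed.

Lemma twist_form d x (p : S) : p \is d.-homog -> twist d x p%:F.
Proof.
move=> hp; exists d, 0%N, p, 1; split.
- by split; [|exact: dhomog1 |].
- by rewrite /eval_at meval1 oner_neq0.
- by rewrite tofrac1 divr1.
Qed.

Lemma twist_formV d x (p : S) : p \is d.-homog -> eval_at p x != 0 ->
  twist (- d%:Z) x p%:F^-1.
Proof.
move=> hp px; exists 0%N, d, 1, p; split=> //; last by rewrite tofrac1 mul1r.
by split; [exact: dhomog1 | | rewrite subrr].
Qed.

(** A local generator of O(a), with its inverse: a power of a coordinate which
    does not vanish at x. *)
Lemma twist_unit a x : exists u : L, [/\ u != 0, twist a x u & twist (- a) x u^-1].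
Proof.
have [i xi] := pt_coord x.
have hX d : ('X_i ^+ d : S) \is d.-homog.
  by rewrite -[X in X.-homog]mul1n; apply: dhomogMn; rewrite dhomogX /= mdeg1.
have Xx d : eval_at ('X_i ^+ d : S) x != 0.
  by rewrite /eval_at rmorphXn /= mevalXU expf_neq0.
case: (intP a) => [|d|d].
- exists 1; rewrite oner_neq0 invr1 oppr0 -tofrac1.
  by split=> //; apply: twist_form; exact: dhomog1.
- exists ('X_i ^+ d.+1)%:F; split; first by rewrite tofrac_neq0 (eval_neq0 (Xx _)).
    exact: twist_form.
  exact: twist_formV.
- exists ('X_i ^+ d.+1)%:F^-1; rewrite invrK opprK; split.
  + by rewrite invr_neq0 // tofrac_neq0 (eval_neq0 (Xx _)).
  + exact: twist_formV.
  + exact: twist_form.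
Qed.

Definition cst (c : k) : L := (c%:MP)%:F.
HB.instance Definition _ := GRing.RMorphism.copy cst
  (@tofrac {mpoly k[n.+1]} \o @mpolyC n.+1 k).

Lemma reg_cst x c : reg x (cst c).
Proof.
apply: (@twist_form 0); apply/dhomogP => m; rewrite msuppC.
by case: eqP => // _; rewrite inE => /eqP ->; rewrite /= mdeg0.
Qed.

Lemma reg0 x : reg x 0.
Proof. by rewrite -[0](rmorph0 cst); exact: reg_cst. Qed.

Lemma reg1 x : reg x 1.
Proof. by rewrite -[1](rmorph1 cst); exact: reg_cst. Qed.

Lemma regM x f g : reg x f -> reg x g -> reg x (f * g).
Proof. by move=> hf hg; have := twistM hf hg; rewrite addr0. Qed.

Lemma regN x f : reg x f -> reg x (- f).
Proof.
move=> hf; rewrite -mulN1r; apply: regM => //.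
by rewrite -[-1](rmorphN1 cst); exact: reg_cst.
Qed.

Lemma twist0 a x : twist a x 0.
Proof.
have [u [_ hu _]] := twist_unit a x; rewrite -(mulr0 u) -[a]addr0.
by apply: twistM => //; exact: reg0.
Qed.

Lemma twist_sum a x (I : Type) (r : seq I) (P : pred I) (F : I -> L) :
  (forall i, P i -> twist a x (F i)) -> twist a x (\sum_(i <- r | P i) F i).
Proof.
by move=> h; elim/big_rec: _ => [|i f Pi]; [exact: twist0 | apply: twistD; exact: h].
Qed.

Lemma reg_prod x (I : Type) (r : seq I) (P : pred I) (F : I -> L) :
  (forall i, P i -> reg x (F i)) -> reg x (\prod_(i <- r | P i) F i).
Proof.
by move=> h; elim/big_rec: _ => [|i f Pi]; [exact: reg1 | apply: regM; exact: h].
Qed.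

Lemma reg_det x r (M : 'M[L]_r) : (forall i j, reg x (M i j)) -> reg x (\det M).
Proof.
move=> h; apply: twist_sum => s _; apply: regM; last exact: reg_prod.
by case: (perm.odd_perm s); rewrite ?expr1 ?expr0; [apply: regN|]; exact: reg1.
Qed.

(** Regularity at some point costs nothing: the denominator only has to be
    nonzero. *)
Lemma ratfunP f : ratfun f <-> exists i (p q : S),
  [/\ p \is i.-homog, q \is i.-homog, q != 0 & f = p%:F / q%:F].
Proof.
split=> [[x [i [j [p [q [[hp hq ija] qx ->]]]]]] | [i [p [q [hp hq q0 ->]]]]].
  exists i, p, q; split=> //; last exact: eval_neq0 qx.
  by have -> : i = j by lia.
have [x qx] := exists_point q0.
by exists x, i, i, p, q; split=> //; rewrite addr0.
Qed.

(** Irreducibility of P^n: two nonempty open subsets meet.  It makes the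
    rational functions a ring. *)
Lemma ratfun2 f g : ratfun f -> ratfun g -> exists x, reg x f /\ reg x g.
Proof.
move=> /ratfunP[i [p [q [hp hq q0 ->]]]] /ratfunP[j [u [v [hu hv v0 ->]]]].
have [x] := exists_point (mulf_neq0 q0 v0).
rewrite /eval_at mevalM mulf_eq0 => /norP[qx vx]; exists x; split.
  by exists i, i, p, q; rewrite addr0.
by exists j, j, u, v; rewrite addr0.
Qed.

Lemma ratfun_reg x f : reg x f -> ratfun f.
Proof. by exists x. Qed.

Lemma ratfunD f g : ratfun f -> ratfun g -> ratfun (f + g).
Proof. by move=> hf hg; have [x [fx gx]] := ratfun2 hf hg; exists x; apply: twistD. Qed.

Lemma ratfunM f g : ratfun f -> ratfun g -> ratfun (f * g).
Proof. by move=> hf hg; have [x [fx gx]] := ratfun2 hf hg; exists x; apply: regM. Qed.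

Lemma ratfun_cst c : ratfun (cst c).
Proof. by exists (pt0 k n); exact: reg_cst. Qed.

Lemma ratfun_sum (I : Type) (r : seq I) (P : pred I) (F : I -> L) :
  (forall i, P i -> ratfun (F i)) -> ratfun (\sum_(i <- r | P i) F i).
Proof.
move=> h; elim/big_rec: _ => [|i f Pi]; last by apply: ratfunD; exact: h.
by rewrite -[0](rmorph0 cst); exact: ratfun_cst.
Qed.

Lemma ratfun_det r (M : 'M[L]_r) : (forall i j, ratfun (M i j)) -> ratfun (\det M).
Proof.
move=> h; apply: ratfun_sum => s _; apply: ratfunM.
  by rewrite -[-1](rmorphN1 cst) -rmorphXn; exact: ratfun_cst.
elim/big_rec: _ => [|i f Pi]; last by apply: ratfunM; exact: h.
by rewrite -[1](rmorph1 cst); exact: ratfun_cst.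
Qed.

Lemma dual_ext (D D' : pt -> L -> Prop) : (forall x f, D x f <-> D' x f) ->
  forall x f, dual D x f <-> dual D' x f.
Proof. by move=> DD' x f; split=> -[rf h]; split=> // g /DD'; exact: h. Qed.

(** The dual of c^-1 O(a), inside the field L, is c O(-a).  The sections of
    [dual] are rational functions by definition, whence the second hypothesis,
    which says that c O(-a) consists of such. *)
Lemma dual_twist a (c : L) : c != 0 ->
  (forall x g, twist (- a) x (c^-1 * g) -> ratfun g) ->
  forall x g, dual (fun y f => twist a y (c * f)) x g <-> twist (- a) x (c^-1 * g).
Proof.
move=> c0 rat x g; split=> [[_ h]|hg].
  have [u [u0 ux uVx]] := twist_unit a x.
  have E1 : c * (c^-1 * u) = u by rewrite mulrA (divff c0) mul1r.
  have r : reg x (g * (c^-1 * u)) by apply: h; rewrite E1.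
  have E2 : u^-1 * (g * (c^-1 * u)) = c^-1 * g.
    by rewrite [g * _]mulrC mulrA [u^-1 * _]mulrC -[c^-1 * u * _]mulrA (divff u0) mulr1.
  by have := twistM uVx r; rewrite addr0 E2.
split=> [|f hf]; first exact: rat hg.
have E : c^-1 * g * (c * f) = g * f.
  by rewrite mulrA [c^-1 * g]mulrC -[g * _ * c]mulrA (mulVf c0) mulr1.
by have := twistM hg hf; rewrite addNr E.
Qed.

End Twists.

(** * The rank of a subsheaf is bounded by its degree *)

(** A maximal minor, selected by g, is nonzero; it is written as a product
    because the pairing below is evaluated on unit vectors. *)
Lemma row_free_minor (F : fieldType) r N (B : 'M[F]_(r, N)) : row_free B ->
  exists g : 'I_r -> 'I_N, \det (rowsub g 1%:M *m B^T) != 0.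
Proof.
move=> fB; have fB' : row_full B^T by rewrite /row_full mxrank_tr.
exists (fullrankfun fB'); rewrite -rowsubE -unitfE -unitmxE.
by rewrite -row_full_unit; exact: fullrowsub_full.
Qed.

Section Rank.
Context (k : closedFieldType) (n N : nat).

Lemma generic_basis_rank (F : stalks k n N) r r' (B : 'M_(r, N)) (B' : 'M_(r', N)) :
  generic_basis F B -> generic_basis F B' -> r = r'.
Proof.
have le r1 r2 (B1 : 'M_(r1, N)) (B2 : 'M_(r2, N)) :
    generic_basis F B1 -> generic_basis F B2 -> (r1 <= r2)%N.
  move=> [f1 in1 _] [f2 _ sub2].
  have -> : r1 = \rank B1 by rewrite (eqP f1).
  have -> : r2 = \rank B2 by rewrite (eqP f2).
  by apply: mxrankS; apply/row_subP => i; have [x Fx] := in1 i; exact: sub2 Fx.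
by move=> h h'; apply/eqP; rewrite eqn_leq (le _ _ _ _ h h') (le _ _ _ _ h' h).
Qed.

Context (r : nat) (B : 'M[L k n]_(r, N)).
Implicit Types s : seq 'rV[L k n]_N.

Definition stack s : 'M[L k n]_(r, N) := \matrix_(l < r) nth 0 s l.
(** The wedge product of the rows of B, as an alternating form on r vectors. *)
Definition pairing s : L k n := \det (stack s *m B^T).

Lemma pairing_multilin : multilin r (pairing : _ -> (L k n)^o).
Proof.
move=> s1 s2 a v w sz; have lt : (size s1 < r)%N by rewrite -sz ltnS leq_addr.
pose i0 := Ordinal lt.
have rows u : row i0 (stack (s1 ++ u :: s2)) = u.
  by apply/rowP => j; rewrite !mxE nth_cat /= ltnn subnn.
have rows' u u' : row' i0 (stack (s1 ++ u :: s2) *m B^T) =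
    row' i0 (stack (s1 ++ u' :: s2) *m B^T).
  apply/matrixP => i j; rewrite !mxE; apply: eq_bigr => l _; congr (_ * _).
  rewrite !mxE !nth_cat; have := neq_lift i0 i.
  rewrite -val_eqE /=; case: ltnP => // le ne.
  by case E : (_ - _)%N => [|z] //=; lia.
have D := @determinant_multilinear _ _ (stack (s1 ++ (a *: v + w) :: s2) *m B^T)
  (stack (s1 ++ v :: s2) *m B^T) (stack (s1 ++ w :: s2) *m B^T) i0 a 1.
rewrite /pairing D ?mul1r //; [|exact: rows'..].
by rewrite !row_mul !rows mulmxDl -scalemxAl scale1r.
Qed.

Lemma pairing_kernel s1 s2 v : (size s1 + size s2).+1 = r ->
  v *m B^T = 0 -> pairing (s1 ++ v :: s2) = 0.
Proof.
move=> sz vB; have lt : (size s1 < r)%N by rewrite -sz ltnS leq_addr.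
rewrite /pairing (expand_det_row _ (Ordinal lt)) big1 // => j _.
suff -> : (stack (s1 ++ v :: s2) *m B^T) (Ordinal lt) j = (v *m B^T) 0 j.
  by rewrite vB mxE mul0r.
rewrite !mxE; apply: eq_bigr => l _; congr (_ * _).
by rewrite !mxE nth_cat /= ltnn subnn.
Qed.
End Rank.

Section Subsheaf.
Context (k : closedFieldType) (n m : nat) (f : 'I_m -> {mpoly k[n.+1]}).
Local Notation L := (L k n).
Local Notation "p %:F" := (@tofrac {mpoly k[n.+1]} p).

(** The syzygy sheaf of an arbitrary family of polynomials. *)
Definition relations : stalks k n m := fun x s =>
  (forall i, reg x (s 0 i)) /\ \sum_j s 0 j * (f j)%:F = 0.

Hypothesis f_free : forall c : 'I_m -> k, \sum_j c j *: f j = 0 -> forall j, c j = 0.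

(** The pairing with constant vectors sends the top exterior power of F to O,
    hence lies in its dual; as the double dual is c^-1 O(a), the pairing
    divided by c is a section of O(-a) at every point.  If r were at least the
    dimension of the space of forms of degree -a, [green_vanishing] would make
    all the maximal minors of the generic basis B vanish. *)
Lemma rank_lt_of_degree (F : stalks k n m) r (a : int) : (0 < n)%N ->
  subsheaf F relations -> has_rank F r -> (0 < r)%N -> has_degree F a ->
  exists e : nat, a = - e%:Z /\ (r < 'C(e + n, e))%N.
Proof.
move=> n_gt0 sub [B0 gB0] r_gt0 [r' [B [gB [c c0 degF]]]].
have rr' := generic_basis_rank gB0 gB; subst r'.
have [freeB inB spanB] := gB.
have rowB i x : F x (row i B) -> (forall j, reg x (B i j)) /\ \sum_j B i j * (f j)%:F = 0.
  move=> /sub[rg ev]; split=> [j|]; first by have := rg j; rewrite mxE.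
  by rewrite -[RHS]ev; apply: eq_bigr => j _; rewrite mxE.
have ratB i j : ratfun (B i j).
  by have [x /rowB[h _]] := inB i; exists x.
have kerB : (\row_j (f j)%:F) *m B^T = 0.
  apply/rowP => i; rewrite !mxE; have [x /rowB[_ E]] := inB i.
  by rewrite -[RHS]E; apply: eq_bigr => j _; rewrite !mxE mulrC.
pose C := map_mx (@cst k n) : 'rV[k]_m -> 'rV[L]_m.
have glob (s : seq 'rV[k]_m) x : twist (- a) x (c^-1 * pairing B (map C s)).
  have regC y l j : reg y (stack r (map C s) l j).
    rewrite !mxE; have [lt|ge] := ltnP l (size s).
      by rewrite (nth_map 0) // mxE; exact: reg_cst.
    by rewrite nth_default ?size_map // mxE; exact: reg0.
  have dualP y : dual (ext_power F B) y (pairing B (map C s)).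
    split=> [|h0].
      apply: ratfun_det => l i; rewrite mxE; apply: ratfun_sum => j _.
      by apply: ratfunM; [exact: ratfun_reg (regC y l j) | rewrite mxE].
    case=> q [b [h [rb Fh ->]]]; rewrite mulr_sumr; apply: twist_sum => i _.
    have [D [FD ->]] := Fh i; rewrite mulrCA; apply: regM => //.
    rewrite /pairing -(det_tr D) -det_mulmx -mulmxA -trmx_mul; apply: reg_det => l i'.
    rewrite mxE; apply: twist_sum => j _; apply: regM => //.
    by have [rg _] := sub _ _ (FD i'); have := rg j; rewrite !mxE.
  have [u [u0 ux uVx]] := twist_unit a x.
  have E1 : c * (c^-1 * u) = u by rewrite mulrA (divff c0) mul1r.
  have [_ /(_ _ (dualP x)) rg] : det_sheaf F B x (c^-1 * u) by apply/degF; rewrite E1.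
  have E2 : u^-1 * (c^-1 * u * pairing B (map C s)) = c^-1 * pairing B (map C s).
    by rewrite [c^-1 * u]mulrC -mulrA mulrA (mulVf u0) mul1r.
  have := twistM uVx rg. rewrite addr0. rewrite E2. done.
have [g detg] := row_free_minor freeB.
(* A nonzero minor, which also shows that the degree of F is not positive. *)
pose s0 := [seq delta_mx 0 (g l) | l <- enum 'I_r] : seq 'rV[k]_m.
have p0 : pairing B (map C s0) != 0.
  suff : stack r (map C s0) = rowsub g 1%:M by rewrite /pairing => ->.
  apply/matrixP => l j; rewrite !mxE -map_comp (nth_map l) ?size_enum_ord //.
  by rewrite nth_ord_enum !mxE eqxx /= [LHS](rmorph_nat (@cst k n)) eq_sym.
have cp0 : c^-1 * pairing B (map C s0) != 0.
  apply: mulf_neq0 p0; rewrite invr_eq0; exact: c0.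
have [e [_ [ae _]]] := global_sections n_gt0 (glob s0) cp0.
exists e; split; first by rewrite -ae opprK.
rewrite ltnNge; apply/negP => le_r.
have exPhi s : exists h : dhomog n.+1 k e,
    c^-1 * pairing B (map C s) == (mpoly_of_dhomog h)%:F.
  have [->|nz] := eqVneq (c^-1 * pairing B (map C s)) 0.
    by exists 0; rewrite tofrac0.
  have [e' [h [e'E E]]] := global_sections n_gt0 (glob s) nz.
  have ee' : e' = e by apply/eqP; rewrite -eqz_nat -ae e'E.
  by move: h E; rewrite ee' => h ->; exists h.
have [Phi PhiE] : exists Phi : seq 'rV[k]_m -> dhomog n.+1 k e, forall s,
    (mpoly_of_dhomog (Phi s))%:F = c^-1 * pairing B (map C s).
  by exists (fun s => xchoose (exPhi s)) => s; apply/esym/eqP/(xchooseP (exPhi s)).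
have Plin := pairing_multilin B.
have lin : multilin r Phi.
  move=> s1 s2 b v w sz.
  have E : pairing B (map C (s1 ++ (b *: v + w) :: s2)) =
      cst n b * pairing B (map C (s1 ++ v :: s2)) + pairing B (map C (s1 ++ w :: s2)).
    rewrite !map_cat !map_cons.
    have -> : C (b *: v + w) = cst n b *: C v + C w by rewrite /C map_mxD map_mxZ.
    by apply: Plin; rewrite !size_map.
  have E' : (mpoly_of_dhomog (Phi (s1 ++ (b *: v + w) :: s2)))%:F =
      (b%:MP * mpoly_of_dhomog (Phi (s1 ++ v :: s2))
        + mpoly_of_dhomog (Phi (s1 ++ w :: s2)))%:F.
    rewrite tofracD tofracM.
    by rewrite (PhiE (_ ++ v :: _)) (PhiE (_ ++ w :: _)) PhiE E mulrDr mulrCA.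
  move/eqP: E'; rewrite tofrac_eq mul_mpolyC => /eqP E'.
  by apply/val_inj; rewrite [LHS]E'.
(* The identity \sum_j f_j * Phi (.. e_j ..) = 0 holds in the ring of
   polynomials; evaluated at y, it is the vanishing of Phi at y. *)
have van : vanishing f r Phi.
  move=> s1 s2 y sz; rewrite (multilin_sum _ lin sz).
  have : pairing B (map C s1 ++ (\row_j (f j)%:F) :: map C s2) = 0.
    by apply: pairing_kernel; rewrite ?size_map.
  rewrite (multilin_sum _ Plin) ?size_map // => /(congr1 ( *%R c^-1)).
  rewrite mulr0 mulr_sumr => E.
  have E' : \sum_j f j * Phi (s1 ++ delta_mx 0 j :: s2) = 0.
    apply/eqP; rewrite -tofrac_eq0 rmorph_sum /= -[X in _ == X]E; apply/eqP.
    apply: eq_bigr => j _; rewrite tofracM PhiE mxE map_cat /= /C map_delta_mx.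
    by rewrite mulrCA.
  rewrite /eval_at linear_sum raddf_sum /=.
  have := congr1 (fun p => eval_at p y) E'; rewrite /eval_at raddf_sum meval0 /= => E''.
  rewrite -[RHS]E''; apply: eq_bigr => j _.
  by rewrite mevalM; transitivity (values_at f y 0 j *
       eval_at (Phi (s1 ++ delta_mx 0 j :: s2)) y); [exact: mevalZ | rewrite mxE].
have := green_vanishing f_free lin van (U := fullv).
move/(_ (fun s _ => memvf _)); rewrite dimvf.
move/(_ le_r s0); rewrite size_map size_enum_ord => /(_ erefl) P0.
by move: cp0; rewrite -PhiE P0 /= tofrac0 eqxx.
Qed.
End Subsheaf.

(** * Linear relations over a field and their minors *)

Section Minors.
Context (R : comNzRingType) (m : nat).
Implicit Types (A : 'M[R]_(m, m.+1)).

(** The j-th maximal minor, with the sign that makes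
    [det_col_mx_minor] an expansion along an added row. *)
Definition minor (j : 'I_m.+1) A : R := (-1) ^+ j * \det (col' j A).

Lemma det_col_mx_minor (u : 'rV_m.+1) A :
  \det (col_mx u A : 'M_(1 + m)) = \sum_j u 0 j * minor j A.
Proof.
rewrite (expand_det_row _ 0); apply: eq_bigr => j _; congr (_ * _).
  by rewrite mxE; case: splitP => i' //= _; rewrite ord1.
rewrite /cofactor add0n; congr (_ * \det _); apply/matrixP => i j'.
rewrite !mxE; case: splitP => [i' /eqP|i' /= /eqP].
  by rewrite /= eq_sym ltn_eqF // (leq_trans (ltn_ord _)).
by rewrite eqSS => /eqP/val_inj ->.
Qed.
End Minors.

(** The maximal minors of a matrix killed by v are proportional to v: the
    vector v_j e_i - v_i e_j is orthogonal to v, so that adding it as a row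
    gives a singular matrix. *)
Lemma minor_swap (F : fieldType) m (A : 'M[F]_(m, m.+1)) (v : 'cV_m.+1) i j :
  A *m v = 0 -> v != 0 -> v j 0 * minor i A = v i 0 * minor j A.
Proof.
move=> Av v0; have [-> //|ne] := eqVneq i j.
pose u : 'rV_m.+1 := v j 0 *: delta_mx 0 i - v i 0 *: delta_mx 0 j.
have uE l : u 0 l = v j 0 * (l == i)%:R - v i 0 * (l == j)%:R by rewrite !mxE !eqxx.
have : \det (col_mx u A : 'M_(1 + m)) = 0.
  apply/eqP; rewrite -det_tr; apply/det0P; exists v^T.
    by apply: contra v0 => /eqP/(congr1 trmx); rewrite trmxK trmx0 => ->.
  rewrite -trmx_mul mul_col_mx Av; apply/eqP; rewrite trmx_eq0 col_mx_eq0 eqxx andbT.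
  apply/eqP/rowP => l; rewrite ord1 !mxE (bigD1 i) //= (bigD1 j) 1?eq_sym //= big1.
    rewrite !uE !eqxx (negPf ne) [j == i]eq_sym (negPf ne).
    by rewrite !mulr0 !mulr1 subr0 sub0r addr0 mulrC mulNr subrr.
  by move=> l' /andP[li lj]; rewrite uE (negPf li) (negPf lj) !mulr0 subr0 mul0r.
rewrite det_col_mx_minor (bigD1 i) //= (bigD1 j) 1?eq_sym //= big1.
  rewrite !uE !eqxx (negPf ne) [j == i]eq_sym (negPf ne).
  by rewrite !mulr0 !mulr1 subr0 sub0r addr0 mulNr => /eqP; rewrite subr_eq0 => /eqP.
by move=> l' /andP[li lj]; rewrite uE (negPf li) (negPf lj) !mulr0 subr0 mul0r.
Qed.

Section RelationBasis.
Context (F : fieldType) (m : nat) (f : 'I_m.+1 -> F).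

(** These are the relations between the f_j obtained by solving for the i-th
    coordinate; [relation_mx] leaves out the trivial one, of index i. *)
Definition relation (i j : 'I_m.+1) : 'rV[F]_m.+1 := delta_mx 0 j - (f j / f i) *: delta_mx 0 i.
Definition relation_mx (i : 'I_m.+1) : 'M[F]_(m, m.+1) := \matrix_l relation i (lift i l).

Lemma relationE i j l : relation i j 0 l = (l == j)%:R - f j / f i * (l == i)%:R.
Proof. by rewrite !mxE eqxx. Qed.

Lemma relation_eval i j : f i != 0 -> \sum_l relation i j 0 l * f l = 0.
Proof.
move=> fi; rewrite (eq_bigr (fun l => (l == j)%:R * f l - f j / f i * ((l == i)%:R * f l))).
  rewrite sumrB -mulr_sumr.
  have S0 i' : \sum_l (l == i')%:R * f l = f i'.
    by rewrite (bigD1 i') //= eqxx mul1r big1 ?addr0 // => l /negPf ->; rewrite mul0r.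
  by rewrite !S0 divfK // subrr.
by move=> l _; rewrite relationE mulrBl mulrA.
Qed.

Lemma col'_relation_mx i : col' i (relation_mx i) = 1%:M.
Proof.
apply/matrixP => l l'; rewrite !mxE eqxx /= (inj_eq lift_inj).
by rewrite [lift i l' == i]eq_sym (negPf (neq_lift _ _)) mulr0 subr0 eq_sym.
Qed.

Lemma minor_relation_mx i : minor i (relation_mx i) = (-1) ^+ i.
Proof. by rewrite /minor col'_relation_mx det1 mulr1. Qed.

Lemma row_free_relation_mx i : row_free (relation_mx i).
Proof.
apply/row_freeP; exists (col' i 1%:M); rewrite -(col'_relation_mx i).
apply/matrixP => l l'; rewrite [LHS]mxE [RHS]mxE (bigD1 (lift i l')) //= big1.
  have -> : (col' i 1%:M : 'M[F]_(m.+1, m)) (lift i l') l' = 1 by rewrite !mxE eqxx.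
  by rewrite mulr1 addr0.
move=> j ne; have -> : (col' i 1%:M : 'M[F]_(m.+1, m)) j l' = 0.
  by rewrite !mxE (negPf ne).
by rewrite mulr0.
Qed.

Lemma relation_decomp p i (A : 'M[F]_(p, m.+1)) : f i != 0 ->
  (forall q, \sum_l A q l * f l = 0) -> A = col' i A *m relation_mx i.
Proof.
move=> fi Af; apply/matrixP => q j.
have E : \sum_l A q l * relation i l 0 j = A q j.
  rewrite (eq_bigr (fun l => A q l * (j == l)%:R - (A q l * f l) * ((f i)^-1 * (j == i)%:R))).
    rewrite sumrB -mulr_suml Af mul0r subr0 (bigD1 j) //= eqxx mulr1 big1 ?addr0 //.
    by move=> l; rewrite eq_sym => /negPf ->; rewrite mulr0.
  by move=> l _; rewrite relationE mulrBr !mulrA.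
rewrite -{1}E mxE (bigD1_ord i) //= relationE divff // mul1r subrr mulr0 add0r.
by apply: eq_bigr => l _; rewrite !mxE.
Qed.
End RelationBasis.

(** * Coherence, rank and degree of the sheaf of relations *)

Section RelationSheaf.
Context (k : closedFieldType) (n d m : nat) (f : 'I_m.+1 -> {mpoly k[n.+1]}).
Local Notation L := (L k n).
Local Notation pt := (pt k n).
Local Notation "p %:F" := (@tofrac {mpoly k[n.+1]} p).
Hypothesis f_homog : forall j, f j \is d.-homog.
Hypothesis f_bpf : forall x : pt, exists j, eval_at (f j) x != 0.
Hypothesis f0_neq0 : f ord0 != 0.
Implicit Types (x y : pt).

Local Notation fF := (fun j => (f j)%:F : L).

Lemma fF_neq0 j x : eval_at (f j) x != 0 -> fF j != 0.
Proof. by move=> fx; rewrite tofrac_neq0 (eval_neq0 fx). Qed.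

Lemma reg_ratio i j x : eval_at (f i) x != 0 -> reg x (fF j / fF i).
Proof.
move=> fi; have := twistM (twist_form x (f_homog j)) (twist_formV (f_homog i) fi).
by rewrite subrr.
Qed.

Lemma relations_relation i j x : eval_at (f i) x != 0 ->
  relations f x (relation fF i j).
Proof.
move=> fi; split=> [l|]; last exact: relation_eval (fF_neq0 fi).
rewrite relationE; apply: twistD.
  by rewrite -(rmorph_nat (@cst k n)); exact: reg_cst.
apply: regN; apply: regM; first exact: reg_ratio.
by rewrite -(rmorph_nat (@cst k n)); exact: reg_cst.
Qed.


(** On the open set where f_i does not vanish, the sheaf is free on the
    relations solved for the i-th coordinate. *)
Lemma relations_coherent : coherent (relations f).
Proof.
move=> x; have [i fi] := f_bpf x.
exists d, (f i), [seq row l (relation_mx fF i) | l <- enum 'I_m]; split=> //.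
  move=> v /mapP[l _ ->] j; exists x; rewrite rowK.
  by have [h _] := relations_relation (lift i l) fi.
move=> y fiy v; split.
  move=> [rv vf]; exists m, (fun l => col' i v 0 l), (fun l => row l (relation_mx fF i)).
  split=> [l|l|]; first by rewrite mxE; exact: rv.
    by apply: map_f; rewrite mem_enum.
  rewrite [LHS](relation_decomp (f := fF) (fF_neq0 fiy)) ?mulmx_sum_row // => q.
  by rewrite (ord1 q).
case=> q [c [s [rc hs ->]]].
have hs' l : relations f y (s l).
  by have /mapP[l' _ ->] := hs l; rewrite rowK; exact: relations_relation.
split=> [j|].
  rewrite summxE; apply: twist_sum => l _; rewrite mxE; apply: regM => //.
  by have [h _] := hs' l.
rewrite (eq_bigr (fun j => \sum_l c l * (s l 0 j * fF j))).
  rewrite exchange_big big1 //= => l _; rewrite -mulr_sumr.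
  by have [_ ->] := hs' l; rewrite mulr0.
move=> j _; rewrite summxE mulr_suml; apply: eq_bigr => l _.
by rewrite mxE mulrA.
Qed.

Lemma relations_basis : generic_basis (relations f) (relation_mx fF ord0).
Proof.
split; first exact: row_free_relation_mx.
  move=> l; have [x fx] := exists_point f0_neq0.
  by exists x; rewrite rowK; exact: relations_relation.
move=> x v [_ vf]; have f0 : fF ord0 != 0 by rewrite tofrac_neq0.
rewrite [v](relation_decomp (f := fF) f0) ?submxMl // => q.
by rewrite (ord1 q).
Qed.

(** The determinant sheaf is f_0 O(-d).  For m sections, stacked in a matrix
    A, the coordinates in the basis of index 0 are the columns of A of index
    <> 0, and their determinant is the minor of index 0.  By [minor_swap] it
    is f_0 / f_i times the minor of index i, which is regular where the
    sections are, and is +-1 when they form the basis of index i. *)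
Lemma relations_ext_power x (h : L) :
  ext_power (relations f) (relation_mx fF ord0) x h <->
  twist (- d%:Z) x ((fF ord0)^-1 * h).
Proof.
have f0 : fF ord0 != 0 by rewrite tofrac_neq0.
have [i fi] := f_bpf x; have fi0 := fF_neq0 fi.
pose fc : 'cV[L]_m.+1 := \col_j fF j.
have fc0 : fc != 0.
  by apply: contra f0 => /eqP/colP/(_ ord0); rewrite !mxE => ->.
have kerE p (A : 'M[L]_(p, m.+1)) : (forall q, relations f x (row q A)) -> A *m fc = 0.
  move=> hA; apply/colP => q; rewrite !mxE; have [_ E] := hA q.
  by rewrite -[RHS]E; apply: eq_bigr => j _; rewrite !mxE.
have swap A : (forall q, relations f x (row q A)) ->
    (fF ord0)^-1 * minor ord0 A = (fF i)^-1 * minor i A.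
  move=> hA; have := minor_swap ord0 i (kerE _ _ hA) fc0; rewrite !mxE => E.
  apply: (mulfI f0); rewrite mulrA (divff f0) mul1r mulrCA -E.
  by rewrite mulrA (mulVf fi0) mul1r.
split.
  case=> q [c [s [rc hs ->]]]; rewrite mulr_sumr; apply: twist_sum => l _.
  have [D [hD ->]] := hs l; rewrite mulrCA -[- _]add0r; apply: twistM; first exact: rc.
  have -> : \det D = minor ord0 (D *m relation_mx fF ord0).
    rewrite /minor expr0 mul1r; congr (\det _).
    rewrite -[LHS]mulmx1 -(col'_relation_mx fF ord0).
    by apply/matrixP => a b; rewrite !mxE; apply: eq_bigr => j _; rewrite !mxE.
  rewrite swap // -[- _]addr0; apply: twistM; first exact: twist_formV.
  apply: regM; first by rewrite -(rmorphN1 (@cst k n)) -rmorphXn; exact: reg_cst.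
  apply: reg_det => a b; rewrite mxE.
  by have [rg _] := hD a; have := rg (lift i b); rewrite mxE.
move=> hh; pose A := relation_mx fF i.
have hA q : relations f x (row q A) by rewrite rowK; exact: relations_relation.
have E : A = col' ord0 A *m relation_mx fF ord0.
  apply: (relation_decomp (f := fF) f0) => q; have [_ E] := hA q.
  by rewrite -[RHS]E; apply: eq_bigr => j _; rewrite !mxE.
(* Coefficient of h on the generator given by the local basis of index i. *)
pose c := (-1) ^+ i * (fF i * ((fF ord0)^-1 * h)).
exists 1%N, (fun=> c), (fun=> \det (col' ord0 A)); split=> [_|_|].
- apply: regM; first by rewrite -(rmorphN1 (@cst k n)) -rmorphXn; exact: reg_cst.
  by have := twistM (twist_form x (f_homog i)) hh; rewrite subrr.
- by exists (col' ord0 A); split=> // q; rewrite -E.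
rewrite big_ord1.
have Ed : \det (col' ord0 A) = fF ord0 * ((fF i)^-1 * (-1) ^+ i).
  have := swap A hA; rewrite minor_relation_mx => <-.
  by rewrite /minor expr0 mul1r mulrA (divff f0) mul1r.
rewrite Ed /c.
have s1 : (-1) ^+ i * (-1) ^+ i = 1 :> L by rewrite -expr2 sqrr_sign.
transitivity (((-1) ^+ i * (-1) ^+ i) * (fF i * (fF i)^-1) * ((fF ord0)^-1 * fF ord0) * h).
  by rewrite s1 (divff fi0) (mulVf f0) !mul1r.
set a := (-1) ^+ i; set b := fF i; set b' := (fF i)^-1; set e := fF ord0; set e' := e^-1.
clearbody a b b' e e'; rewrite [RHS]/GRing.scale /=.
ring.
Qed.
End RelationSheaf.

Section Degree.
Context (k : closedFieldType) (n d m : nat) (f : 'I_m.+1 -> {mpoly k[n.+1]}).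
Local Notation L := (L k n).
Local Notation pt := (pt k n).
Local Notation "p %:F" := (@tofrac {mpoly k[n.+1]} p).
Hypothesis f_homog : forall j, f j \is d.-homog.
Hypothesis f_bpf : forall x : pt, exists j, eval_at (f j) x != 0.
Hypothesis f0_neq0 : f ord0 != 0.

Lemma ratfun_of_form_mul p x (g : L) : p \is d.-homog -> p != 0 ->
  twist d x (p%:F * g) -> ratfun g.
Proof.
move=> hp p0 [i [j [u [v [[hu hv ij] vx E]]]]]; apply/ratfunP.
have v0 := eval_neq0 vx; have pF0 : p%:F != 0 by rewrite tofrac_neq0.
exists i, u, (v * p); split=> //.
- have -> : i = (j + d)%N by lia.
  exact: dhomogM.
- exact: mulf_neq0 v0 p0.
rewrite tofracM invfM mulrA -E [RHS]mulrC mulrA.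
by rewrite (mulVf pF0) mul1r.
Qed.

(** Both duals are taken by [dual_twist], first with c = 1 / f_0, then with
    c = f_0. *)
Lemma relations_degree : has_degree (relations f) (- d%:Z).
Proof.
have f0 : (f ord0)%:F != 0 by rewrite tofrac_neq0.
exists m, (relation_mx (fun j => (f j)%:F) ord0); split; first exact: relations_basis.
exists (f ord0)%:F^-1; first by rewrite invr_neq0.
move=> x g; set c := (f ord0)%:F in f0 *.
have D1 y h : dual (ext_power (relations f) (relation_mx (fun j => (f j)%:F) ord0)) y h
    <-> twist d y (c * h).
  have e := dual_twist (a := - d%:Z) (c := c^-1) _ _ y h.
  rewrite opprK invrK in e; rewrite -e; first exact/dual_ext/relations_ext_power.
    by rewrite invr_neq0.
  by move=> z h'; exact: ratfun_of_form_mul.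
rewrite /det_sheaf (dual_ext D1); apply: dual_twist => // y h hh.
exists y; have := twistM (twist_form y (f_homog ord0)) hh.
by rewrite subrr mulrA (divff f0) mul1r.
Qed.
End Degree.

(** * Numerical inequalities *)
Lemma P_poly_natE n e : (P_poly n).[e%:R] = 'C(e + n, e)%:R.
Proof.
rewrite /P_poly hornerZ horner_prod.
rewrite (eq_bigr (fun i => (e + i)%:R)) => [|i _]; last by rewrite !hornerE natrD.
rewrite -natr_prod.
have -> : (\prod_(1 <= i < n.+1) (e + i) = (e + n) ^_ n)%N.
  elim: n => [|n IH]; first by rewrite big_geq // ffactn0.
  by rewrite big_nat_recr //= IH addnS ffactSS mulnC.
have -> : 'C(e + n, e) = 'C(e + n, n) by rewrite -bin_sub ?leq_addr // addKn.
by rewrite -bin_ffact natrM mulrC mulfK // pnatr_eq0 -lt0n fact_gt0.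
Qed.

Lemma Q_poly_natE n e : (0 < n)%N -> (0 < e)%N ->
  (Q_poly n.-1).[e%:R] = ('C(e + n, e)%:R - 1) / e%:R.
Proof.
case: n => // n _ e0; rewrite -P_poly_natE.
have /(congr1 (fun p => p.[e%:R])) := Q_polyE n.
rewrite hornerM hornerX hornerD hornerN hornerC => <-.
by rewrite mulfK // pnatr_eq0 -lt0n.
Qed.

(** The monotonicity of Q_{n-1}, one step at a time: by the recurrence of the
    binomial coefficients a step reduces to e (n - 1) >= 1. *)
Lemma binomial_quotient_mono n e e' : (1 < n)%N -> (0 < e <= e')%N ->
  ('C(e + n, e)%:R - 1) / e%:R <= ('C(e' + n, e')%:R - 1) / e'%:R :> rat.
Proof.
move=> n_gt1 /andP[e_gt0 le_ee']; rewrite -(subnKC le_ee').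
elim: (e' - e)%N => [|t IH]; first by rewrite addn0.
apply: le_trans IH _; rewrite addnS.
have : (0 < e + t)%N by rewrite addn_gt0 e_gt0.
move: (e + t)%N => {e e' e_gt0 le_ee' t} e e_gt0.
rewrite ler_pdivrMr ?ltr0n // mulrAC ler_pdivlMr ?ltr0n //.
have E : (e.+1 * 'C(e.+1 + n, e.+1) = (e.+1 + n) * 'C(e + n, e))%N.
  by rewrite addSn mul_bin_diag.
have c0 : (0 < 'C(e + n, e))%N by rewrite bin_gt0 leq_addr.
suff h : (e.+1 * e.+1 * 'C(e + n, e) <= e * (e.+1 * 'C(e.+1 + n, e.+1)) + e.+1)%N.
  rewrite -(ler_pM2l (x := e.+1%:R)) ?ltr0n //.
  move: h; rewrite -(ler_nat rat) !(natrD, natrM) => h.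
  set c : rat := 'C(e + n, e)%:R in h *; set c' : rat := 'C(e.+1 + n, e.+1)%:R in h *.
  clearbody c c'.
  have -> : e.+1%:R = e%:R + 1 :> rat by rewrite -natr1.
  rewrite -natr1 in h; lra.
rewrite E mulnA; nia.
Qed.

Lemma bin_gt1 a b : (0 < a)%N -> (0 < b)%N -> (1 < 'C(a + b, a))%N.
Proof.
case: a b => // a [] // b _ _; rewrite addSn binS.
by apply: (@leq_add 1 1); rewrite bin_gt0; lia.
Qed.

Lemma slope_le r r' (e d : nat) : (0 < r)%N -> (0 < r')%N ->
  (slope r (- e%:Z) <= slope r' (- d%:Z)) = (d%:R * r%:R <= e%:R * r'%:R :> rat).
Proof.
move=> r0 r'0; rewrite /slope !rmorphN /= !mulNr lerN2.
by rewrite ler_pdivrMr ?ltr0n // mulrAC ler_pdivlMr ?ltr0n // -!pmulrn.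
Qed.

Lemma slope_lt r r' (e d : nat) : (0 < r)%N -> (0 < r')%N ->
  (slope r (- e%:Z) < slope r' (- d%:Z)) = (d%:R * r%:R < e%:R * r'%:R :> rat).
Proof. by move=> r0 r'0; rewrite !real_ltNge ?num_real // slope_le. Qed.

(** If e >= d, the bound r < m - 1 suffices.  Otherwise r / e is at most
    q = Q_{n-1}(d-1), and t = d q + 1. *)
Lemma slope_bound n d m e r : (1 < n)%N -> (1 < d)%N ->
  (0 < r < m.-1)%N -> (r < 'C(e + n, e))%N ->
  let t := (P_poly n).[d%:R - 1] + (Q_poly n.-1).[d%:R - 1] in
  (t <= m%:R -> slope r (- e%:Z) <= slope m.-1 (- d%:Z)) /\
  (t < m%:R -> slope r (- e%:Z) < slope m.-1 (- d%:Z)).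
Proof.
move=> n_gt1 d_gt1 /andP[r_gt0 lt_rm] lt_r t.
have n_gt0 := ltnW n_gt1; have m_gt0 : (0 < m.-1)%N by lia.
rewrite slope_le // slope_lt //.
have Em : m%:R = m.-1%:R + 1 :> rat by rewrite natr1 prednK //; lia.
have [le_de|lt_ed] := leqP d e.
  suff lt : (d%:R * r%:R < e%:R * m.-1%:R :> rat) by split=> // _; exact: ltW.
  by rewrite -!natrM ltr_nat; nia.
have e_gt0 : (0 < e)%N.
  by rewrite lt0n; apply: contraTneq lt_r => ->; rewrite bin0 -leqNgt.
have Ed1 : d%:R - 1 = d.-1%:R :> rat by rewrite -[in LHS](@prednK d) 1?ltnW // -natr1 addrK.
have d1_gt0 : (0 < d.-1)%N by lia.
have : t = 'C(d.-1 + n, d.-1)%:R + ('C(d.-1 + n, d.-1)%:R - 1) / d.-1%:R.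
  by rewrite /t Ed1 P_poly_natE Q_poly_natE.
have le_q : r%:R / e%:R <= ('C(d.-1 + n, d.-1)%:R - 1) / d.-1%:R :> rat.
  apply: le_trans (_ : ('C(e + n, e)%:R - 1) / e%:R <= _); last first.
    by apply: binomial_quotient_mono => //; rewrite e_gt0; lia.
  rewrite ler_pM2r ?invr_gt0 ?ltr0n // lerBrDr natr1 ler_nat //.
set q : rat := (_ - 1) / _ in le_q * => Et.
have Eq : 'C(d.-1 + n, d.-1)%:R = d.-1%:R * q + 1 :> rat.
  by rewrite /q mulrC divfK ?subrK // pnatr_eq0 -lt0n.
have {}Et : t = d%:R * q + 1 by rewrite Et Eq -[in RHS](@prednK d) 1?ltnW // -natr1; ring.
have le_r : r%:R <= q * e%:R by rewrite -ler_pdivrMr ?ltr0n.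
have le_dr : d%:R * r%:R <= e%:R * (d%:R * q).
  by rewrite mulrCA ler_wpM2l ?ler0n // mulrC.
have e0 : 0 < e%:R :> rat by rewrite ltr0n.
rewrite Et Em; split=> h.
  by apply: le_trans le_dr _; rewrite ler_pM2l // -(lerD2r 1).
by apply: le_lt_trans le_dr _; rewrite ltr_pM2l // -(ltrD2r 1).
Qed.

(** * Stability *)
Lemma relations_slope_stable (ltmu : rel rat) (k : closedFieldType) n d m
    (f : 'I_m -> {mpoly k[n.+1]}) :
  (forall j, f j \is d.-homog) ->
  (forall x : pt k n, exists j, eval_at (f j) x != 0) ->
  (forall c : 'I_m -> k, \sum_j c j *: f j = 0 -> forall j, c j = 0) ->
  (0 < n)%N -> (1 < m)%N ->
  (forall r e, (0 < r < m.-1)%N -> (r < 'C(e + n, e))%N ->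
     ltmu (slope r (- e%:Z)) (slope m.-1 (- d%:Z))) ->
  slope_stable_for ltmu (relations f).
Proof.
case: m f => // m f f_homog f_bpf f_free n_gt0 m_gt1 lt_mu.
have f0 : f ord0 != 0.
  apply/negP => /eqP f0; have := f_free (fun j => (j == ord0)%:R).
  rewrite (bigD1 ord0) //= f0 scaler0 add0r big1 => [|j /negPf ->]; last by rewrite scale0r.
  by move/(_ erefl ord0)/eqP; rewrite eqxx oner_eq0.
split; first exact: relations_coherent.
exists m, (- d%:Z); split=> //.
- by eexists; exact: relations_basis.
- exact: relations_degree.
move=> F r a _ subF rkF /andP[r_gt0 lt_rm] degF.
have [e [-> lt_r]] := rank_lt_of_degree f_free n_gt0 subF rkF r_gt0 degF.
by apply: lt_mu lt_r; rewrite r_gt0.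
Qed.

Section SyzygySheaf.
Context (k : closedFieldType) (n d : nat) (V : {vspace dhomog n.+1 k d}).

Definition basis_form (j : 'I_(\dim V)) : {mpoly k[n.+1]} :=
  mpoly_of_dhomog (tnth (vbasis V) j).

Lemma basis_form_free (c : 'I_(\dim V) -> k) :
  \sum_j c j *: basis_form j = 0 -> forall j, c j = 0.
Proof.
move=> E; have /freeP := basis_free (vbasisP V); apply.
apply: val_inj => /=; rewrite linear_sum /= -[RHS]E.
by apply: eq_bigr => j _; rewrite /basis_form (tnth_nth 0).
Qed.

Lemma basis_form_bpf : base_point_free V ->
  forall x, exists j, eval_at (basis_form j) x != 0.
Proof.
move=> bpf x; have [g gV gx] := bpf x.
apply/existsP; apply: contraNT gx => /existsPn nz.
rewrite (coord_vbasis gV) /eval_at linear_sum raddf_sum big1 //= => j _.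
transitivity (coord (vbasis V) j g * eval_at (basis_form j) x).
  by rewrite /basis_form (tnth_nth 0); exact: mevalZ.
by rewrite (eqP (negPn (nz j))) mulr0.
Qed.
End SyzygySheaf.

Theorem theorem1 (k : closedFieldType) (n d m : nat)
    (V : {vspace dhomog n.+1 k d}) :
  (2 <= n)%N -> (2 <= d)%N -> base_point_free V -> \dim V = m ->
  ((P_poly n).[d%:R - 1] + (Q_poly n.-1).[d%:R - 1] < m%:R <= (P_poly n).[d%:R] ->
     stable (syzygy_sheaf V)) /\
  (m%:R = (P_poly n).[d%:R - 1] + (Q_poly n.-1).[d%:R - 1] ->
     semistable (syzygy_sheaf V)).
Proof.
move=> n_gt1 d_gt1 bpf <-.
have hV j : basis_form (V := V) j \is d.-homog by exact: dhomog_is_dhomog.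
(* Hence m > 1, and the rank m - 1 is positive. *)
have lt1t : 1 < (P_poly n).[d%:R - 1] + (Q_poly n.-1).[d%:R - 1] :> rat.
  have -> : d%:R - 1 = d.-1%:R :> rat.
    by rewrite -[in LHS](@prednK d) 1?ltnW // -natr1 addrK.
  rewrite P_poly_natE Q_poly_natE ?(ltnW n_gt1) //; last by lia.
  have c1 : 1 < 'C(d.-1 + n, d.-1)%:R :> rat by rewrite ltr1n bin_gt1; lia.
  rewrite -[ltLHS]addr0 ltrD // divr_gt0 ?subr_gt0 // ltr0n; lia.
split=> [/andP[lt_t _]|eq_t].
  apply: (relations_slope_stable hV (basis_form_bpf bpf) (@basis_form_free _ _ _ V)).
  - exact: ltnW.
  - by rewrite -(ltr_nat rat); exact: lt_trans lt_t.
  move=> r e hr lt_r.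
  by have [_ ->] := slope_bound n_gt1 d_gt1 hr lt_r.
apply: (relations_slope_stable hV (basis_form_bpf bpf) (@basis_form_free _ _ _ V)).
- exact: ltnW.
- by rewrite -(ltr_nat rat) eq_t.
move=> r e hr lt_r.
by have [-> //] := slope_bound n_gt1 d_gt1 hr lt_r; rewrite eq_t.
Qed.
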